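(* If $\Gamma \leq \mathrm{Diff}^{\omega}_{+}(I)$ is solvable, then $h_{\mathrm{strict}}(\Gamma) = 1$.
   Context: $I=[0,1]$, $\mathrm{Homeo}_{+}(I)$ is the group of orientation-preserving homeomorphisms of $I$, and $\mathrm{Diff}^{\omega}_{+}(I)$ is the group of orientation-preserving (real) analytic diffeomorphisms of the closed interval $I$. For a subgroup $G \le \mathrm{Homeo}_+(I)$, an orbital of $G$ is the convex hull of the $G$-orbit of a point of $I$, provided this convex hull contains more than one point; orbitals are open intervals. For $g \in G$, an orbital of $g$ means an orbital of the cyclic group $\langle g\rangle$ (equivalently, a connected component of $I \setminus \mathrm{Fix}(g)$). A signed orbital of $G$ is a pair $(A,g)$ with $g\in G$ and $A$ an orbital of $g$; $g$ is called its signature. A tower $T$ of $G$ is a set of signed orbitals of $G$ such that the intervals occurring as first coordinates form a chain under inclusion, and for each interval $A$ occurring as a first coordinate in $T$ there is exactly one element of $T$ of the form $(A,g)$. Let $O_T$ denote the set of intervals occurring as first coordinates in $T$; the height of $T$ is the cardinality of $O_T$. Two intervals $(a,b)$ and $(c,d)$ share an end if $a=c$ or $b=d$. A tower $T$ is strict if no two distinct intervals in $O_T$ share an end. The strict height $h_{\mathrm{strict}}(G)$ is the supremum of the heights of the strict towers of $G$ if this supremum is finite, and $h_{\mathrm{strict}}(G)=\infty$ otherwise.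
   Formalization: The group Γ is additionally assumed to be non-trivial: for the trivial group no element has an orbital, so the only tower is empty and the strict height is 0, not 1. *)

(* Defs.v *)
From HB Require Import structures.
From mathcomp Require Import all_boot all_order all_algebra.
From mathcomp Require Import all_classical all_reals all_analysis.

Set Implicit Arguments.
Unset Strict Implicit.
Unset Printing Implicit Defensive.

Import Order.TTheory GRing.Theory Num.Theory.
Import numFieldNormedType.Exports.

Local Open Scope classical_set_scope.
Local Open Scope ring_scope.

Section Solvable.
Context {G : groupType}.
Implicit Types (A H : set G).
Local Open Scope group_scope.

Definition subgroup H := group_closed (fun x => x \in H).

Definition subgroup_gen A : set G := smallest subgroup A.

Definition derived_subgroup H : set G :=
  subgroup_gen [set z | exists x y, [/\ H x, H y & z = [~ x, y]]].

Definition solvable_subgroup H :=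
  exists n : nat, iter n derived_subgroup H = [set 1].

End Solvable.

(* The closed interval [0, 1] as a type, with the subtype topology. *)
Definition unitI (R : realType) := set_type (`[0, 1]%classic : set R).

Section HomeoI.
Variable R : realType.

Record homeoI := HomeoI {
  homeo_fun :> unitI R -> unitI R;
  homeo_inv : unitI R -> unitI R;
  homeo_funK : cancel homeo_fun homeo_inv;
  homeo_invK : cancel homeo_inv homeo_fun;
  homeo_cont : continuous homeo_fun;
  homeo_inv_cont : continuous homeo_inv;
  homeo_incr : {homo homeo_fun : x y / \val x < \val y :> R} }.

Lemma homeoI_eq (f g : homeoI) : f =1 g -> f = g.
Proof.
move=> /funext; case: f g => [f f' fK f'K cf cf' If] [g g' gK g'K cg cg' Ig] /=.
move=> fg; subst g.
have e : f' = g' by apply/funext => x; rewrite -{1}(g'K x) fK.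
by subst g'; congr HomeoI; exact: Prop_irrelevance.
Qed.

Definition homeoI1 : homeoI.
Proof.
by refine (@HomeoI id id _ _ _ _ _) => //; move=> x; exact: cvg_id.
Defined.

Definition homeoIM (f g : homeoI) : homeoI.
Proof.
refine (@HomeoI (f \o g) (homeo_inv g \o homeo_inv f) _ _ _ _ _).
- exact: can_comp (homeo_funK f) (homeo_funK g).
- exact: can_comp (homeo_invK g) (homeo_invK f).
- by move=> x; apply: continuous_comp; exact: homeo_cont.
- by move=> x; apply: continuous_comp; exact: homeo_inv_cont.
- by move=> x y xy; do 2 apply: homeo_incr.
Defined.

Definition homeoIV (f : homeoI) : homeoI.
Proof.
refine (@HomeoI (homeo_inv f) f _ _ _ _ _).
- exact: homeo_invK.
- exact: homeo_funK.
- exact: homeo_inv_cont.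
- exact: homeo_cont.
- move=> x y; rewrite -{1}(homeo_invK f x) -{1}(homeo_invK f y).
  move: (homeo_inv f x) (homeo_inv f y) => {}x {}y fxy.
  case: (ltgtP (\val x) (\val y)) => // [/(homeo_incr f)|/val_inj xy].
  + by rewrite ltNge (ltW fxy).
  + by move: fxy; rewrite xy ltxx.
Defined.

HB.instance Definition _ := gen_eqMixin homeoI.
HB.instance Definition _ := gen_choiceMixin homeoI.

Fact homeoIMA : associative homeoIM.
Proof. by move=> f g h; exact: homeoI_eq. Qed.
Fact homeoI1M : left_id homeoI1 homeoIM.
Proof. by move=> f; exact: homeoI_eq. Qed.
Fact homeoIM1 : right_id homeoI1 homeoIM.
Proof. by move=> f; exact: homeoI_eq. Qed.
Fact homeoIVM : left_inverse homeoI1 homeoIV homeoIM.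
Proof. by move=> f; apply: homeoI_eq => x; exact: homeo_funK. Qed.
Fact homeoIMV : right_inverse homeoI1 homeoIV homeoIM.
Proof. by move=> f; apply: homeoI_eq => x; exact: homeo_invK. Qed.

HB.instance Definition _ :=
  isGroup.Build homeoI homeoIMA homeoI1M homeoIM1 homeoIVM homeoIMV.

(* At the end points the expansion is only required on the side lying in
   [0, 1]; a power series converging there converges on a two-sided
   neighbourhood, so this is analyticity in a neighbourhood of [0, 1]. *)
Definition analyticI (f : unitI R -> unitI R) :=
  forall x0 : unitI R, exists (a : R^nat) (r : R), 0 < r /\
    forall x : unitI R, `|\val x - \val x0| < r ->
      pseries a (\val x - \val x0) @ \oo --> \val (f x).

Definition diff_omega : set homeoI :=
  [set f : homeoI | analyticI f /\ analyticI (homeo_inv f)].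

Definition orbital (G : set homeoI) : set (set R) :=
  [set A | ~ is_subset1 A /\
    exists x : unitI R, A = [set` Rhull [set \val (g x) | g in G]]].

Definition elt_orbital (g : homeoI) := orbital (subgroup_gen [set g]).

Definition signed_orbital (G : set homeoI) : set (set R * homeoI) :=
  [set p | G p.2 /\ elt_orbital p.2 p.1].

Definition tower_intervals (T : set (set R * homeoI)) : set (set R) :=
  [set p.1 | p in T].

Definition tower (G : set homeoI) (T : set (set R * homeoI)) :=
  [/\ T `<=` signed_orbital G,
      total_on (tower_intervals T) subset
    & forall A, tower_intervals T A -> exists! g, T (A, g)].

Definition share_end (A B : set R) :=
  exists a b c d : R, [/\ a < b, c < d, A = `]a, b[%classic,
    B = `]c, d[%classic & a = c \/ b = d].

Definition strict_tower (G : set homeoI) (T : set (set R * homeoI)) :=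
  tower G T /\ forall A B, tower_intervals T A -> tower_intervals T B ->
    A <> B -> ~ share_end A B.

(* An infinite height counts as +oo, whatever the infinite cardinality. *)
Definition tower_height (T : set (set R * homeoI)) : \bar R :=
  counting (tower_intervals T).

Definition strict_height (G : set homeoI) : \bar R :=
  ereal_sup [set tower_height T | T in strict_tower G].

End HomeoI.

(* Main.v *)
Require Import Defs.
From mathcomp Require Import all_boot all_order all_algebra.
From mathcomp Require Import all_classical all_reals all_analysis.
From mathcomp Require Import ring lra.

(** Every nontrivial element of [Gamma] has an orbital, which is a strict tower
    of height 1.  The content is the upper bound: two intervals of a strict
    tower would give [c < a < b < d] and elements [f], [g] of [Gamma] with
    orbitals [(a, b)] and [(c, d)], and this is refuted in
    [no_nested_orbitals].

    Let [N] be the last nontrivial term of the derived series of [Gamma]: an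
    abelian normal subgroup ([solvable_abelian_normal]).  Fixed points of a
    nontrivial analytic map cannot accumulate, so a map that permutes them in
    increasing order fixes each of them ([fix_of_permutes_fix]).  Applied to
    commuting elements of [N] this shows that all nontrivial elements of [N]
    have the same fixed set [F]; applied to conjugates of an element of [N] by
    [Gamma], that [Gamma] fixes [F] pointwise.  As [g] has no fixed point in
    [(c, d)], the segment [[a, b]] lies in a component [(p, q)] of the
    complement of [F], on which [N] acts freely, so comparing the images of one
    point makes [N] an Archimedean ordered group.  The same argument, with the fixed points of [f], shows that [f]
    commutes with no nontrivial element of [N], since such an element would
    fix [a].

    Conjugating by [f] or its inverse makes any positive element of [N]
    smaller, so [N] is densely ordered ([positive_root]).  Moreover [f] fixes
    [a] and [b] and contracts [(a, b)] to one of its ends; this forces every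
    positive element of [N] to push [a] beyond [b] ([positive_jumps]): the
    interval [(a, b)] is wandering under a dense group of translations, and
    it remains to exclude this in the manner of Denjoy.  Fix [h > 1] in [N] and
    let [L] be the image of [[a, b]] under [h^-n], close to [p] for large [n],
    with left end [x].  Maps analytic at [p] have Lipschitz difference quotients
    there, so the ratio of the length of [[x, h x]] to that of [L] stays bounded
    ([bounded_distortion]).  For given [M] there is a positive [l] in [N]
    with [l^M <= h]; the images of [L] under [l^i], [i < M], are disjoint
    subintervals of [[x, h x]], and each is at least half as long as [L] when
    [n] is large, because [l^i] moves points away from its fixed point [p].  So
    the ratio is at least [M / 2] for every [M] ([no_positive_element]). *)

Set Implicit Arguments.
Unset Strict Implicit.
Unset Printing Implicit Defensive.

Import Order.TTheory GRing.Theory Num.Theory.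
Import numFieldNormedType.Exports.

Local Open Scope classical_set_scope.
Local Open Scope ring_scope.

(** * Subgroups and the derived series *)

Section Subgroups.
Context {G : groupType}.
Implicit Types A H K : set G.
Local Open Scope group_scope.

Lemma subgroup1 H : subgroup H -> H 1.
Proof. by move=> [/set_mem]. Qed.

Lemma subgroupV H : subgroup H -> forall x, H x -> H x^-1.
Proof. by move=> sH x /mem_set Hx; exact/set_mem/(group_closedV sH). Qed.

Lemma subgroupM H : subgroup H -> forall x y, H x -> H y -> H (x * y).
Proof.
by move=> sH x y /mem_set Hx /mem_set Hy; exact/set_mem/(group_closedM sH).
Qed.

Lemma subgroupX H : subgroup H -> forall x n, H x -> H (x ^+ n).
Proof.
move=> sH x n Hx; elim: n => [|n IHn]; first exact: subgroup1.
by rewrite expgS; exact: subgroupM.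
Qed.

Lemma subgroupI H : H 1 -> (forall x y, H x -> H y -> H (x / y)) -> subgroup H.
Proof.
move=> H1 HD; split; first exact: mem_set.
by move=> x y /set_mem Hx /set_mem Hy; exact/mem_set/HD.
Qed.

Lemma subgroup_gen_subgroup A : subgroup (subgroup_gen A).
Proof.
apply: subgroupI => [K [sK _]|x y Ax Ay K [sK AK]]; first exact: subgroup1.
by apply: (subgroupM sK); [exact: Ax|apply: (subgroupV sK); exact: Ay].
Qed.

Lemma derived_subgroup_sub H K : subgroup K -> H `<=` K ->
  derived_subgroup H `<=` K.
Proof.
move=> sK HK; apply: smallest_sub => // _ [x [y [/HK Kx /HK Ky ->]]].
rewrite commgEl conjgE; apply: (subgroupM sK); first exact: subgroupV.
by apply: (subgroupM sK); [exact: subgroupV|exact: subgroupM].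
Qed.

Lemma derived_subgroup_conj H x : (forall h, H h -> H (h ^ x)) ->
  forall h, derived_subgroup H h -> derived_subgroup H (h ^ x).
Proof.
move=> Hx.
suff : derived_subgroup H `<=` [set k | derived_subgroup H (k ^ x)] by [].
apply: smallest_sub.
- have sD : subgroup (derived_subgroup H) by exact: subgroup_gen_subgroup.
  apply: (@subgroupI [set k | derived_subgroup H (k ^ x)]) => [|y z] /=.
    by rewrite conj1g; exact: subgroup1.
  rewrite conjMg conjVg => Dy Dz; apply: (subgroupM sD) => //.
  exact: (subgroupV sD).
- move=> _ [y [z [Hy Hz ->]]] /=; apply: sub_gen_smallest => //.
  by exists (y ^ x), (z ^ x); rewrite conjRg; split => //; exact: Hx.
Qed.

Lemma derived_trivial_commute H : derived_subgroup H = [set 1] ->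
  forall x y, H x -> H y -> commute x y.
Proof.
move=> D1 x y Hx Hy; apply/commgP/eqP.
suff : [set 1] [~ x, y] by [].
by rewrite -D1; apply: sub_gen_smallest => //; exists x, y.
Qed.

(** The witness is the last nontrivial term of the derived series. *)
Lemma solvable_abelian_normal H :
  subgroup H -> solvable_subgroup H -> H <> [set 1] ->
  exists N : set G, [/\ subgroup N, N `<=` H,
    forall x h, H x -> N h -> N (h ^ x),
    forall x y, N x -> N y -> commute x y
    & exists2 h, N h & h <> 1].
Proof.
move=> sH [n Hn] H1.
have [m Dm Dm1] : exists2 m, iter m derived_subgroup H <> [set 1] &
    iter m.+1 derived_subgroup H = [set 1].
  elim: n Hn => [//|n IHn] Hn.
  by have [/IHn //|Dn] := pselect (iter n derived_subgroup H = [set 1]); exists n.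
have sN k : subgroup (iter k derived_subgroup H).
  by case: k => //= k; exact: subgroup_gen_subgroup.
exists (iter m derived_subgroup H); split => //.
- elim: (m) => //= k IHk; exact: derived_subgroup_sub.
- move=> x h Hx; elim: (m) h => [|k IHk] h /=.
    move=> Hh; rewrite conjgE; apply: (subgroupM sH); first exact: subgroupV.
    exact: subgroupM.
  exact: derived_subgroup_conj.
- exact: derived_trivial_commute.
- apply: contrapT => noh; apply: Dm; apply/seteqP; split => h /=.
    by move=> Nh; apply: contrapT => h1; apply: noh; exists h.
  by move=> ->; exact: subgroup1.
Qed.

End Subgroups.

(** * The action on the real line *)

Section Action.
Variable R : realType.
Implicit Types (f g h : homeoI R) (s t x y : R).

(** Extending by the identity outside [0, 1] gives an action by increasing
    bijections of the whole line, so that points, suprema and infima are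
    real numbers rather than elements of a subtype. *)
Definition act g t : R :=
  if insub t is Some u then \val (g (u : unitI R)) else t.

Lemma act_val g (u : unitI R) : act g (\val u) = \val (g u).
Proof. by rewrite /act valK. Qed.

Lemma unitI_surj t : 0 <= t <= 1 -> exists u : unitI R, \val u = t.
Proof.
move=> t01; have tI : t \in (`[0, 1]%classic : set R).
  by apply: mem_set; rewrite /= in_itv.
by exists (SigSub tI).
Qed.

Lemma unitI_bounds (u : unitI R) : 0 <= \val u <= 1.
Proof. by have := set_mem (valP u); rewrite /= in_itv. Qed.

Lemma act_out g t : ~~ (0 <= t <= 1) -> act g t = t.
Proof.
move=> t01; rewrite /act; case: insubP => //= u /set_mem /=.
by rewrite in_itv /= (negbTE t01).
Qed.

Lemma act_in g t : 0 <= t <= 1 -> 0 <= act g t <= 1.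
Proof. by move=> /unitI_surj[u <-]; rewrite act_val unitI_bounds. Qed.

Lemma act1 t : act 1%g t = t.
Proof.
have [/unitI_surj[u <-]|/act_out->//] := boolP (0 <= t <= 1).
by rewrite act_val.
Qed.

Lemma actM f g t : act (f * g)%g t = act f (act g t).
Proof.
have [/unitI_surj[u <-]|t01] := boolP (0 <= t <= 1); first by rewrite !act_val.
by rewrite !act_out.
Qed.

Lemma actKV g : cancel (act (g^-1)%g) (act g).
Proof. by move=> t; rewrite -actM mulgV act1. Qed.

Lemma actVK g : cancel (act g) (act (g^-1)%g).
Proof. by move=> t; rewrite -actM mulVg act1. Qed.

Lemma act_inj g : injective (act g). Proof. exact: can_inj (actVK g). Qed.

Lemma act_mono g s t : s < t -> act g s < act g t.
Proof.
move=> st.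
have [s01|s01] := boolP (0 <= s <= 1); have [t01|t01] := boolP (0 <= t <= 1).
- have [u us] := unitI_surj s01; have [v vt] := unitI_surj t01.
  by rewrite -us -vt !act_val; apply: homeo_incr; rewrite us vt.
- by rewrite (act_out g t01); have := act_in g s01; lra.
- by rewrite (act_out g s01); have := act_in g t01; lra.
- by rewrite !act_out.
Qed.

Lemma ltr_act g s t : (act g s < act g t) = (s < t).
Proof.
have [st|ts|->] := ltgtP s t; last by rewrite ltxx.
- by rewrite act_mono.
- by apply/negbTE; rewrite -leNgt; exact/ltW/act_mono.
Qed.

Lemma ler_act g s t : (act g s <= act g t) = (s <= t).
Proof. by rewrite leNgt ltr_act -leNgt. Qed.

Lemma act_fixV g t : act g t = t -> act (g^-1)%g t = t.
Proof. by move=> gt; rewrite -{1}gt actVK. Qed.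

Lemma act_fixVE g t : (act (g^-1)%g t = t) <-> (act g t = t).
Proof. by split=> [/act_fixV|/act_fixV //]; rewrite invgK. Qed.

Lemma act_eq1 g : (forall t, 0 <= t <= 1 -> act g t = t) -> g = 1%g.
Proof.
move=> gE; apply: homeoI_eq => u; apply: val_inj.
by rewrite -act_val gE // unitI_bounds.
Qed.

Lemma act0 g : act g 0 = 0.
Proof.
have ge0 h : 0 <= act h 0 by have /andP[] := @act_in h 0 ltac:(lra).
by apply/eqP; rewrite eq_le ge0 andbT -{2}(actKV g 0) ler_act.
Qed.

Lemma act_1 g : act g 1 = 1.
Proof.
have le1 h : act h 1 <= 1 by have /andP[] := @act_in h 1 ltac:(lra).
by apply/eqP; rewrite eq_le le1 /= -{1}(actKV g 1) ler_act.
Qed.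

Lemma actX_fix g t n : act g t = t -> act (g ^+ n)%g t = t.
Proof.
by move=> gt; elim: n => [|n IHn]; rewrite ?act1 // expgS actM IHn.
Qed.

Lemma act_sup g (A : set R) : A !=set0 -> has_ubound A ->
  (forall t, A t -> act g t = t) -> act g (sup A) = sup A.
Proof.
move=> A0 Aub Afix.
have le h : (forall t, A t -> act h t = t) -> sup A <= act h (sup A).
  move=> hA; apply: ge_sup => // t At.
  by rewrite -(hA _ At) ler_act; exact: ub_le_sup.
apply/eqP; rewrite eq_le le // andbT -{2}(actKV g (sup A)) ler_act.
by apply: le => t /Afix/act_fixV.
Qed.

Lemma act_inf g (A : set R) : A !=set0 -> has_lbound A ->
  (forall t, A t -> act g t = t) -> act g (inf A) = inf A.
Proof.
move=> A0 Alb Afix.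
have ge h : (forall t, A t -> act h t = t) -> act h (inf A) <= inf A.
  move=> hA; apply: lb_le_inf => // t At.
  by rewrite -(hA _ At) ler_act; exact: ge_inf.
apply/eqP; rewrite eq_le ge //= -{1}(actKV g (inf A)) ler_act.
by apply: ge => t /Afix/act_fixV.
Qed.

(** Otherwise the supremum of the orbit of [x] would be a fixed point in
    [[x, y]]. *)
Lemma act_escape g x y : (forall t, x <= t <= y -> act g t != t) ->
  x < act g x -> exists n, y < act (g ^+ n)%g x.
Proof.
move=> nofix xgx; apply: contrapT => noesc.
have orb n : act (g ^+ n)%g x <= y.
  by rewrite leNgt; apply/negP => yn; apply: noesc; exists n.
pose A := range (fun n => act (g ^+ n)%g x).
have Ax : A x by exists 0; rewrite // expg0 act1.
have ubA : ubound A y by move=> _ [n _ <-].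
have supA t : A t -> t <= sup A by apply: ub_le_sup; exists y.
have xs : x <= sup A by exact: supA.
have sy : sup A <= y by apply: ge_sup => //; exists x.
have gs : act g (sup A) <> sup A by apply/eqP; rewrite nofix // xs.
apply: gs; apply/eqP; rewrite eq_le; apply/andP; split.
- rewrite leNgt; apply/negP => lt.
  have: act (g^-1)%g (sup A) < sup A by rewrite -(ltr_act g) actKV.
  move=> /(sup_gt (ex_intro _ x Ax))[_ [n _ <-]].
  rewrite -(ltr_act g) actKV -actM -expgS ltNge.
  by move=> /negP; apply; apply: supA; exists n.+1.
- apply: ge_sup => [|_ [n _ <-]]; first by exists x.
  apply: (@le_trans _ _ (act (g ^+ n.+1)%g x)).
    by rewrite expgSr actM ler_act ltW.
  by rewrite expgS actM ler_act; apply: supA; exists n.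
Qed.

(** An intermediate value property: if [g] moved [x] and [y] in opposite
    directions, the orbit of one of them would escape beyond the other one,
    against monotonicity. *)
Lemma act_sign g p q : (forall t, p < t < q -> act g t != t) ->
  forall x y, p < x < q -> p < y < q -> x < act g x -> y < act g y.
Proof.
move=> nofix x y /andP[px xq] /andP[py yq] xgx.
have nofixV t : p < t < q -> act (g^-1)%g t != t.
  by move=> /nofix; apply: contra => /eqP/act_fixVE ->.
have gy := nofix y ltac:(lra).
have [//|gyy|/esym/eqP] := ltgtP y (act g y); last by rewrite (negbTE gy).
have [xy|yx] := leP x y.
- have [|n] := @act_escape g x y _ xgx.
    by move=> t ?; apply: nofix; lra.
  have : act (g ^+ n)%g x <= y.
    elim: n => [|n IHn]; first by rewrite act1.
    by rewrite expgS actM (le_trans _ (ltW gyy)) // ler_act.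
  lra.
- have ygV : y < act (g^-1)%g y by rewrite -(ltr_act g) actKV.
  have [|n] := @act_escape (g^-1)%g y x _ ygV.
    by move=> t ?; apply: nofixV; lra.
  have : act (g^-1 ^+ n)%g y <= x.
    elim: n => [|n IHn]; first by rewrite act1 ltW.
    by rewrite expgS actM -(ler_act g) actKV (le_trans IHn) // ltW.
  lra.
Qed.

End Action.

(** * Power series estimates *)

Section PowerSeries.
Variable R : realType.
Implicit Types (a b u : R^nat) (s t x y z rho C B : R).

Lemma series_half_bound u B n : (forall j, `|u j| <= B / 2 ^+ j) ->
  `|series u n| <= 2 * B.
Proof.
move=> uB; have B0 : 0 <= B by have := uB 0; rewrite divr1; exact: le_trans.
suff : `|series u n| <= B * (2 - 2 / 2 ^+ n).
  move/le_trans; apply; rewrite [2 * B]mulrC ler_wpM2l // gerBl.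
  by rewrite divr_ge0 // exprn_ge0.
elim: n => [|n IHn]; first by rewrite /series /= big_geq // normr0 divr1 subrr mulr0.
rewrite seriesSr (le_trans (ler_normD _ _)) // (le_trans (lerD IHn (uB n))) //.
have e0 : (2 ^+ n : R) != 0 by rewrite expf_neq0.
rewrite exprS le_eqVlt; apply/orP; left; apply/eqP.
by field.
Qed.

Lemma pseries_coef_bound a t : t != 0 -> cvgn (pseries a t) ->
  exists2 C : R, 0 <= C & forall n, `|a n| * `|t| ^+ n <= C.
Proof.
move=> t0 /cvg_series_cvg_0 a0.
have /cvg_seq_bounded/ex_bound[|C /= aC] : cvgn (fun n => a n * t ^+ n).
- by apply/cvg_ex; exists 0.
- exact: (@globally_properfilter _ _ 0%N).
have aC' n : `|a n| * `|t| ^+ n <= C by rewrite -normrX -normrM; exact: aC.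
by exists C => //; have := aC' 0; rewrite expr0 mulr1; exact: le_trans.
Qed.

(** If [b i] is the first nonzero coefficient, the tail of the series is
    [O(|t|^(i+1))] and cannot cancel [b i * t ^ i] for small [t]. *)
Lemma pseries_isolated_zeros b rho C : 0 < rho ->
  (forall n, `|b n| * rho ^+ n <= C) ->
  (forall e : R, 0 < e -> exists t, 0 < `|t| < e /\ pseries b t @ \oo --> (0 : R)) ->
  forall n, b n = 0.
Proof.
move=> rho0 bC zb; elim/ltn_ind => i bi.
have C0 : 0 <= C by have := bC 0; rewrite expr0 mulr1; exact: le_trans.
apply/eqP; rewrite -normr_le0 leNgt; apply/negP => bi0.
have r_gt0 : 0 < rho ^+ i.+1 by rewrite exprn_gt0.
have [|t [/andP[t0 te] bt]] := zb (Num.min (rho / 2) (`|b i| * rho ^+ i.+1 / (2 * C + 1))).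
  by rewrite lt_min !divr_gt0 ?mulr_gt0 //; lra.
move: te; rewrite lt_min => /andP[t_rho tsmall].
pose q := `|t| / rho.
have q0 : 0 <= q by rewrite divr_ge0 // ltW.
have q12 : q <= 1 / 2 by rewrite ler_pdivrMr //; lra.
have term j : `|b j * t ^+ j| <= C * q ^+ j.
  rewrite normrM normrX /q expr_div_n [C * _]mulrA [C * _ / _]mulrAC.
  rewrite ler_pM2r ?exprn_gt0 //.
  by rewrite ler_pdivlMr ?exprn_gt0.
have bnd : `|0 - b i * t ^+ i| <= 2 * (C * q ^+ i.+1).
  apply: (@cvgr_to_le _ \oo _ R (fun n => `|pseries b t n - b i * t ^+ i|)).
    by apply: cvg_norm; apply: cvgB => //; exact: cvg_cst.
  near=> n.
  have ni : (i.+1 <= n)%N by near: n; exact: nbhs_infty_ge.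
  have -> : pseries b t n - b i * t ^+ i =
      series (fun j => b (j + i.+1)%N * t ^+ (j + i.+1)%N) (n - i.+1)%N.
    rewrite /pseries /series /= (big_cat_nat (n := i.+1)) //= big_nat_recr //=.
    rewrite big_nat_cond big1 => [|j /andP[/andP[_ ji] _]]; last by rewrite bi // mul0r.
    by rewrite add0r addrAC subrr add0r -{1}[i.+1]add0n big_addn.
  apply: series_half_bound => j; apply: le_trans (term _) _.
  rewrite addnC exprD mulrA ler_wpM2l //.
    by rewrite mulr_ge0 ?exprn_ge0.
  by rewrite -exprVn lerXn2r ?nnegrE //; lra.
move: bnd; rewrite sub0r normrN normrM normrX /q expr_div_n.
have ti : 0 < `|t| ^+ i by rewrite exprn_gt0.
rewrite (exprS `|t|) => bnd.
have : `|b i| * rho ^+ i.+1 <= 2 * C * `|t|.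
  rewrite -ler_pdivlMr // -(ler_pM2r ti) (le_trans bnd) // le_eqVlt.
  by apply/orP; left; apply/eqP; ring.
move: tsmall; rewrite ltr_pdivlMr; last lra.
nra.
Unshelve. all: by end_near.
Qed.

Lemma power_diff_bound s y z j : `|y| <= s -> `|z| <= s ->
  s * `|z ^+ j - y ^+ j| <= j%:R * s ^+ j * `|z - y|.
Proof.
move=> ys zs; have s0 : 0 <= s by rewrite (le_trans _ ys).
elim: j => [|j IHj]; first by rewrite !expr0 subrr normr0 !mulr0 mul0r.
have -> : z ^+ j.+1 - y ^+ j.+1 = z * (z ^+ j - y ^+ j) + y ^+ j * (z - y).
  by rewrite !exprS; ring.
apply: le_trans (ler_wpM2l s0 (ler_normD _ _)) _.
rewrite !normrM normrX mulrDr -[j.+1]addn1 natrD mulrDl mulrDl addn1 !exprS.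
apply: lerD.
  rewrite mulrCA; apply: le_trans (_ : s * (s * `|z ^+ j - y ^+ j|) <= _).
    by rewrite ler_wpM2r // mulr_ge0.
  by apply: le_trans (ler_wpM2l s0 IHj) _; rewrite -!mulrA mulrCA.
by rewrite mul1r mulrA ler_wpM2r // ler_wpM2l // lerXn2r ?nnegrE.
Qed.

(** The quantity estimated is the product of the three differences with the
    second divided difference of the monomial, a form that makes sense when
    the points coincide. *)
Lemma power_diff2_bound s x y z j : `|x| <= s -> `|y| <= s -> `|z| <= s ->
  s ^+ 2 * `|(z ^+ j - x ^+ j) * (y - x) - (y ^+ j - x ^+ j) * (z - x)| <=
  j%:R ^+ 2 * s ^+ j * (`|z - x| * `|y - x| * `|z - y|).
Proof.
move=> xs ys zs; have s0 : 0 <= s by rewrite (le_trans _ ys).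
set P := (X in _ <= _ * X).
have P0 : 0 <= P by rewrite /P !mulr_ge0.
elim: j => [|j IHj].
  by rewrite !expr0 !subrr !mul0r subrr normr0 mulr0 expr2 !mul0r.
set D := (X in _ * `|X| <= _) in IHj.
have -> : (z ^+ j.+1 - x ^+ j.+1) * (y - x) - (y ^+ j.+1 - x ^+ j.+1) * (z - x)
    = x * D + (z ^+ j - y ^+ j) * ((z - x) * (y - x)).
  by rewrite /D !exprS; ring.
apply: le_trans (ler_wpM2l (exprn_ge0 _ s0) (ler_normD _ _)) _.
rewrite !normrM mulrDr.
have h1 : s ^+ 2 * (`|x| * `|D|) <= s * (j%:R ^+ 2 * s ^+ j * P).
  rewrite mulrCA; apply: le_trans (ler_wpM2l s0 IHj).
  by rewrite ler_wpM2r // mulr_ge0 // exprn_ge0.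
have h2 : s ^+ 2 * (`|z ^+ j - y ^+ j| * (`|z - x| * `|y - x|)) <= s * (j%:R * s ^+ j * P).
  have -> : s ^+ 2 * (`|z ^+ j - y ^+ j| * (`|z - x| * `|y - x|)) =
    (s * (s * `|z ^+ j - y ^+ j|)) * (`|z - x| * `|y - x|) by ring.
  have -> : s * (j%:R * s ^+ j * P) = s * (j%:R * s ^+ j * `|z - y|) * (`|z - x| * `|y - x|).
    by rewrite /P; ring.
  rewrite ler_wpM2r ?mulr_ge0 // ler_wpM2l //; exact: power_diff_bound.
apply: le_trans (lerD h1 h2) _.
have -> : s * (j%:R ^+ 2 * s ^+ j * P) + s * (j%:R * s ^+ j * P) =
  (j%:R ^+ 2 + j%:R) * (s ^+ j.+1 * P) by rewrite [s ^+ j.+1]exprS; ring.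
rewrite -mulrA ler_wpM2r //.
  by rewrite mulr_ge0 // exprn_ge0.
by rewrite -[j.+1]addn1 natrD; have : (0 : R) <= j%:R by []; nra.
Qed.

Lemma sqrn_le_exp4 j : (j%:R ^+ 2 : R) <= 4 ^+ j.
Proof.
have -> : (4 : R) = 2 ^+ 2 by rewrite expr2; lra.
rewrite -exprM mulnC exprM lerXn2r ?nnegrE ?exprn_ge0 //.
by rewrite -natrX ler_nat ltnW // ltn_expl.
Qed.

(** Shrinking the radius by 8 absorbs the factor [j ^ 2 <= 4 ^ j] of the
    [j]-th term and leaves a geometric series of ratio 1/2. *)
Lemma pseries_diff2_bound a rho C s x y z fx fy fz : 0 < rho -> s = rho / 8 ->
  (forall n, `|a n| * rho ^+ n <= C) ->
  `|x| <= s -> `|y| <= s -> `|z| <= s ->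
  pseries a x @ \oo --> fx -> pseries a y @ \oo --> fy ->
  pseries a z @ \oo --> fz ->
  `|(fz - fx) * (y - x) - (fy - fx) * (z - x)| <=
  2 * C / s ^+ 2 * (`|z - x| * `|y - x| * `|z - y|).
Proof.
move=> rho0 sE aC xs ys zs ax ay az.
have s0 : 0 < s by rewrite sE; lra.
set P := (X in _ <= _ * X).
have P0 : 0 <= P by rewrite /P !mulr_ge0.
apply: (@cvgr_to_le _ \oo _ R (fun n => `|(pseries a z n - pseries a x n) * (y - x)
   - (pseries a y n - pseries a x n) * (z - x)|)).
  by apply: cvg_norm; apply: cvgB; apply: cvgMr_tmp; exact: cvgB.
near=> n.
have -> : (pseries a z n - pseries a x n) * (y - x)
   - (pseries a y n - pseries a x n) * (z - x) =
   series (fun j => a j * ((z ^+ j - x ^+ j) * (y - x) - (y ^+ j - x ^+ j) * (z - x))) n.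
  rewrite /pseries /series /= -!sumrB !mulr_suml -sumrB.
  by apply: eq_bigr => j _; ring.
have -> : 2 * C / s ^+ 2 * P = 2 * (C / s ^+ 2 * P) by ring.
apply: series_half_bound => j; rewrite normrM.
have s2 : 0 < s ^+ 2 by rewrite exprn_gt0.
set D := `|_ - _ * _|.
have D1 : D <= j%:R ^+ 2 * s ^+ j * P / s ^+ 2.
  by rewrite ler_pdivlMr // mulrC; exact: power_diff2_bound.
apply: le_trans (ler_wpM2l (normr_ge0 _) D1) _.
have h : `|a j| * s ^+ j <= C / 8 ^+ j.
  by rewrite sE expr_div_n mulrA ler_wpM2r ?invr_ge0 ?exprn_ge0.
have Ps : 0 <= P / s ^+ 2 by rewrite divr_ge0 // ltW.
have -> : `|a j| * (j%:R ^+ 2 * s ^+ j * P / s ^+ 2) =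
  (j%:R ^+ 2 * (`|a j| * s ^+ j)) * (P / s ^+ 2) by ring.
have -> : C / s ^+ 2 * P / 2 ^+ j = (C / 2 ^+ j) * (P / s ^+ 2) by ring.
rewrite ler_wpM2r //.
have C0 : 0 <= C by have := aC 0; rewrite expr0 mulr1; exact: le_trans.
apply: (@le_trans _ _ (4 ^+ j * (C / 8 ^+ j))).
  apply: ler_pM (sqrn_le_exp4 j) h; first exact: sqr_ge0.
  by rewrite mulr_ge0 // exprn_ge0 // ltW.
have -> : (8 : R) = 4 * 2 by lra.
rewrite exprMn le_eqVlt; apply/orP; left; apply/eqP.
by field; rewrite !expf_neq0.
Unshelve. all: by end_near.
Qed.

End PowerSeries.

(** * Local properties of analytic maps *)

Section Analytic.
Variable R : realType.
Implicit Types (g : homeoI R) (s t x y z : R).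

Lemma analytic_expansion g x0 : analyticI g -> 0 <= x0 <= 1 ->
  exists a C rho, [/\ 0 < rho, forall n, `|a n| * rho ^+ n <= C
    & forall t, 0 <= t <= 1 -> `|t - x0| < rho ->
      pseries a (t - x0) @ \oo --> act g t].
Proof.
move=> ga x01; have [u ux0] := unitI_surj x01.
have [a [r [r0 ar]]] := ga u; rewrite ux0 in ar.
have ar' t : 0 <= t <= 1 -> `|t - x0| < r -> pseries a (t - x0) @ \oo --> act g t.
  by move=> /unitI_surj[v <-] ?; rewrite act_val; exact: ar.
(* A step [m] small enough for [x0 + m] or [x0 - m] to lie in [0, 1]: one
   point of convergence already bounds the coefficients. *)
pose m := Num.min r 1 / 2.
have m0 : 0 < m by rewrite divr_gt0 // lt_min r0 ltr01.
have [min1 minr] : Num.min r 1 <= 1 /\ Num.min r 1 <= r.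
  by rewrite !ge_min !lexx orbT.
have [m12 mr] : m <= 1 / 2 /\ m < r by rewrite /m; lra.
have [t [t01 tm]] : exists t, 0 <= t <= 1 /\ `|t - x0| = m.
  have [x12|x12] := leP x0 (1 / 2).
    by exists (x0 + m); split; [lra|rewrite addrC addKr gtr0_norm].
  by exists (x0 - m); split; [lra|rewrite addrC addKr normrN gtr0_norm].
have [||C C0 aC] := @pseries_coef_bound _ a (t - x0).
- by rewrite -normr_gt0 tm.
- by apply/cvg_ex; exists (act g t); apply: ar'; rewrite // tm.
exists a, C, m; split=> // [n|s s01 sm].
  by rewrite -tm; exact: aC.
by apply: ar' => //; exact: lt_trans mr.
Qed.

(** The second divided difference of [g] is bounded by [K] on the points of
    [[p, 1]] at distance at most [d] from [p]; equivalently, the difference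
    quotients of [g] are there [K]-Lipschitz in each variable. *)
Definition diff2_bounded_at g p K d := forall x y z,
  p <= x <= 1 -> p <= y <= 1 -> p <= z <= 1 ->
  x <= p + d -> y <= p + d -> z <= p + d ->
  `|(act g z - act g x) * (y - x) - (act g y - act g x) * (z - x)| <=
  K * (`|z - x| * `|y - x| * `|z - y|).

Lemma analytic_diff2_bounded g p : analyticI g -> 0 <= p <= 1 ->
  exists K d, [/\ 0 <= K, 0 < d & diff2_bounded_at g p K d].
Proof.
move=> ga p01; have [a [C [rho [rho0 aC ag]]]] := analytic_expansion ga p01.
have C0 : 0 <= C by have := aC 0; rewrite expr0 mulr1; exact: le_trans.
have s0 : 0 < rho / 8 by lra.
exists (2 * C / (rho / 8) ^+ 2), (rho / 8); split => //.
  by rewrite divr_ge0 ?exprn_ge0 //; lra.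
move=> x y z x1 y1 z1 xp yp zp.
have small t : p <= t <= 1 -> t <= p + rho / 8 -> `|t - p| <= rho / 8.
  by move=> *; rewrite ger0_norm; lra.
have lim t : p <= t <= 1 -> t <= p + rho / 8 -> pseries a (t - p) @ \oo --> act g t.
  by move=> t1 tp; apply: ag; [lra|apply: le_lt_trans (small _ t1 tp) _; lra].
have := @pseries_diff2_bound _ a rho C (rho / 8) (x - p) (y - p) (z - p) _ _ _
  rho0 erefl aC (small _ x1 xp) (small _ y1 yp) (small _ z1 zp)
  (lim _ x1 xp) (lim _ y1 yp) (lim _ z1 zp).
have e u v : u - p - (v - p) = u - v by ring.
by rewrite !e.
Qed.

Lemma analytic_fix_local g x0 : analyticI g -> 0 <= x0 <= 1 ->
  (forall e : R, 0 < e -> exists t, [/\ 0 <= t <= 1, 0 < `|t - x0| < e & act g t = t]) ->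
  exists2 e, 0 < e &
    forall t, 0 <= t <= 1 -> `|t - x0| < e -> act g t = t.
Proof.
move=> ga x01 acc; have [a [C [rho [rho0 aC ag]]]] := analytic_expansion ga x01.
(* The coefficients of [g (x0 + t) - (x0 + t)] as a power series in [t]. *)
pose b n := a n - (if n == 0%N then x0 else if n == 1%N then 1 else 0).
have bg t : 0 <= t <= 1 -> `|t - x0| < rho ->
    pseries b (t - x0) @ \oo --> act g t - t.
  move=> t01 trho.
  have -> : pseries b (t - x0) = pseries a (t - x0) \-
      pseries (fun n => if n == 0%N then x0 else if n == 1%N then 1 else 0)
        (t - x0).
    apply/funext => n; rewrite /pseries /series /= -sumrB.
    by apply: eq_bigr => j _; rewrite /b mulrBl.
  apply: cvgB; first exact: ag.
  apply: (@cvg_near_cst _ _ _ _ \oo).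
  near=> n; have n2 : (2 <= n)%N by near: n; exact: nbhs_infty_ge.
  rewrite /pseries /series /= (big_cat_nat (n := 2)) //= big_nat_recr //= big_nat1.
  rewrite /= big_nat_cond big1 => [|j /andP[/andP[j2 _] _]].
    by rewrite expr0 expr1; ring.
  by case: j j2 => [|[|j]]; rewrite // mul0r.
have b0 n : b n = 0.
  apply: (@pseries_isolated_zeros _ b rho (C + `|x0| + rho)) => // [k|e e0].
    have : `|b k| * rho ^+ k <= (`|a k| +
        `|if k == 0%N then x0 else if k == 1%N then 1 else 0|) * rho ^+ k.
      by rewrite ler_wpM2r ?exprn_ge0 ?(ltW rho0) // /b ler_normB.
    move/le_trans; apply; rewrite mulrDl -addrA lerD //.
    case: k => [|[|k]] /=; rewrite ?expr0 ?expr1 ?mulr1 ?normr1 ?normr0 ?mul1r ?mul0r.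
    - by rewrite lerDl ltW.
    - by rewrite lerDr.
    - by rewrite addr_ge0 // ltW.
  have [|t [t01 /andP[t0 te] gt]] := acc (Num.min e rho); first by rewrite lt_min e0.
  move: te; rewrite lt_min => /andP[te trho].
  exists (t - x0); rewrite t0 te; split => //.
  by have := bg _ t01 trho; rewrite gt subrr.
exists rho => // t t01 trho; apply/eqP; rewrite -subr_eq0; apply/eqP.
apply: (cvg_unique _ (bg _ t01 trho)) => //.
have -> : pseries b (t - x0) = cst 0; last exact: cvg_cst.
apply/funext => n; rewrite /pseries /series /= big1 // => j _.
by rewrite b0 mul0r.
Unshelve. all: by end_near.
Qed.

End Analytic.

(** * Fixed points of analytic maps *)

Section Identity.
Variable R : realType.
Implicit Types (e g h : homeoI R) (d s t x y z : R).

(** The points near which [g] is the identity form an open subset of [0, 1],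
    which is also closed by the local statement. *)
Lemma analytic_fix_accumulation g x0 : analyticI g -> 0 <= x0 <= 1 ->
  (forall d, 0 < d -> exists t, [/\ 0 <= t <= 1, 0 < `|t - x0| < d & act g t = t]) ->
  g = 1%g.
Proof.
move=> ga x01 acc.
pose O := [set t : R | exists2 d, 0 < d &
  forall u, 0 <= u <= 1 -> `|u - t| < d -> act g u = u].
pose I : set R := `[0, 1]%classic.
have IE t : I t <-> 0 <= t <= 1 by rewrite /I /= in_itv.
have Ox0 : O x0 by exact: analytic_fix_local.
suff IO : I `&` O = I.
  apply: act_eq1 => t t01.
  have [_ [d d0]] : (I `&` O) t by rewrite IO; exact/IE.
  by apply => //; rewrite subrr normr0.
apply: (@segment_connected R 0 1).
- by exists x0; split => //; exact/IE.
- exists O => //; rewrite openE => t [d d0 td].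
  apply/nbhs_ballP; exists (d / 2); rewrite /= ?divr_gt0 // => s.
  rewrite /ball /= => ts; exists (d / 2); rewrite ?divr_gt0 // => u u01 us.
  apply: td => //; have -> : u - t = (u - s) - (t - s) by ring.
  by apply: le_lt_trans (ler_normB _ _) _; lra.
- exists (closure (I `&` O)); first exact: closed_closure.
  apply/seteqP; split => t; first by move=> IOt; split; [case: IOt|exact: subset_closure].
  move=> [It cl]; split => //; apply: analytic_fix_local => //.
  move=> d d0.
  have [s [[/IE s01 [d' d'0 sd']]]] : I `&` O `&` ball t d !=set0.
    by apply: cl; exact: nbhsx_ballx.
  rewrite /ball /= => tsd; rewrite distrC in tsd.
  have [st|st] := eqVneq s t; last first.
    exists s; split => //; last by apply: sd' => //; rewrite subrr normr0.
    by rewrite tsd andbT normr_gt0 subr_eq0.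
  rewrite st in sd'.
  (* Here [t] has a neighbourhood of fixed points; one of them is not [t]. *)
  pose m := Num.min 1 (Num.min d d') / 2.
  have m0 : 0 < m by rewrite divr_gt0 // !lt_min ltr01 d0 d'0.
  have [m1 [md md']] : m <= 1 / 2 /\ m < d /\ m < d'.
    have : Num.min 1 (Num.min d d') <= 1 /\ Num.min 1 (Num.min d d') <= d /\
      Num.min 1 (Num.min d d') <= d' by rewrite !ge_min !lexx !orbT.
    by rewrite /m; lra.
  have [u [u01 um]] : exists u, 0 <= u <= 1 /\ `|u - t| = m.
    have [t12|t12] := leP t (1 / 2).
      by exists (t + m); split; [lra|rewrite addrC addKr gtr0_norm].
    by exists (t - m); split; [lra|rewrite addrC addKr normrN gtr0_norm].
  exists u; split => //; first by rewrite um m0 md.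
  by apply: sd' => //; rewrite um.
Qed.

(** Otherwise the [e]-orbit of [x] would be an increasing sequence of fixed
    points of [g], accumulating at its supremum. *)
Lemma fix_orbit_increasing g e x : analyticI g -> g <> 1%g -> 0 <= x <= 1 ->
  act g x = x -> (forall y, act g y = y -> act g (act e y) = act e y) ->
  act e x <= x.
Proof.
move=> ga g1 x01 gx ge; rewrite leNgt; apply/negP => xex; apply: g1.
pose a n := act (e ^+ n)%g x.
have ga_ n : act g (a n) = a n.
  by elim: n => [|n IHn]; rewrite /a ?expg0 ?act1 // expgS actM ge.
have a01 n : 0 <= a n <= 1 by exact: act_in.
have aS n : a n < a n.+1 by rewrite /a expgSr actM ltr_act.
have ub : has_ubound (range a) by exists 1 => _ [n _ <-]; have := a01 n; lra.
have ne : range a !=set0 by exists x; exists 0%N => //; rewrite /a expg0 act1.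
have as_ n : a n < sup (range a).
  by apply: lt_le_trans (aS n) _; apply: ub_le_sup => //; exists n.+1.
apply: (@analytic_fix_accumulation _ (sup (range a))) => //.
  apply/andP; split; first by have := a01 0%N; have := as_ 0%N; lra.
  by apply: ge_sup => // _ [n _ <-]; have := a01 n; lra.
move=> d d0; have : sup (range a) - d < sup (range a) by lra.
move=> /(sup_gt ne)[_ [n _ <-]] dn; exists (a n); split => //.
have asn := as_ n; rewrite distrC gtr0_norm; last lra.
by apply/andP; split; lra.
Qed.

(** This replaces finiteness of the fixed set: an increasing permutation of a
    finite set is the identity. *)
Lemma fix_of_permutes_fix g e x : analyticI g -> g <> 1%g -> 0 <= x <= 1 ->
  act g x = x -> (forall y, act g y = y <-> act g (act e y) = act e y) ->
  act e x = x.
Proof.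
move=> ga g1 x01 gx ge; apply/eqP; rewrite eq_le; apply/andP; split.
  by apply: (@fix_orbit_increasing g) => // y /ge.
rewrite -(ler_act e^-1%g) actVK; apply: (@fix_orbit_increasing g) => // y gy.
by apply/ge; rewrite actKV.
Qed.

End Identity.

(** * Orbitals of one element *)

Section Orbitals.
Variable R : realType.
Implicit Types (e f g h : homeoI R) (s t x y z : R).

Lemma cyclic_fix g t :
  act g t = t -> forall e, subgroup_gen [set g] e -> act e t = t.
Proof.
move=> gt; suff : subgroup_gen [set g] `<=` [set e | act e t = t] by [].
apply: smallest_sub => [|_ -> //].
apply: (@subgroupI _ [set e | act e t = t]) => [|x y /= xt yt]; first exact: act1.
by rewrite actM (act_fixV yt).
Qed.

(** The infimum and supremum of an orbit are fixed, so they do not belong to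
    it unless it is a point; a fixed point strictly between them would
    separate the orbit. *)
Lemma elt_orbitalP g A : elt_orbital g A ->
  exists a b, [/\ 0 <= a, a < b, b <= 1, A = `]a, b[%classic &
    [/\ act g a = a, act g b = b & forall t, a < t < b -> act g t != t]].
Proof.
move=> [A1 [u AE]].
set H := subgroup_gen [set g] in AE.
have sH : subgroup H by exact: subgroup_gen_subgroup.
have Hg : H g by exact: sub_gen_smallest.
pose X : set R := [set act e (\val u) | e in H].
have XE : [set \val (e u) | e in H] = X.
  by apply/seteqP; split => _ [e He <-]; exists e => //; rewrite act_val.
rewrite XE in AE.
have Xu : X (\val u) by exists 1%g; [exact: subgroup1|exact: act1].
have X01 t : X t -> 0 <= t <= 1.
  by move=> [e _ <-]; apply: act_in; exact: unitI_bounds.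
have hub : has_ubound X by exists 1 => t /X01/andP[].
have hlb : has_lbound X by exists 0 => t /X01/andP[].
have nX : X !=set0 by exists (\val u).
have Xact e t : H e -> X t -> X (act e t).
  move=> He [e' He' <-]; exists (e * e')%g; last by rewrite actM.
  exact: (subgroupM sH).
(* A point of [X] fixed by [g] is all of [X], whose hull is then a point. *)
have nofix t : X t -> act g t != t.
  move=> [e He <-]; apply/eqP => /cyclic_fix fix_; apply: A1.
  have uE : act e (\val u) = \val u.
    by have := fix_ _ (subgroupV sH He); rewrite actVK => <-.
  have X1 : X = [set \val u].
    apply/seteqP; split => [_ [e' He' <-]|_ -> //] /=.
    by rewrite -{1}uE fix_.
  rewrite AE X1 => x y /=; rewrite /Rhull.
  rewrite !(asboolT (_ : [set \val u] _)) ?sup1 ?inf1 //.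
  rewrite !asboolT ?in_itv /=; last 2 first.
  - by exists (\val u) => _ ->.
  - by exists (\val u) => _ ->.
  by lra.
have ga : act g (inf X) = inf X.
  have le h : H h -> act h (inf X) <= inf X.
    move=> Hh; apply: lb_le_inf => // t Xt.
    rewrite -(actKV h t) ler_act; apply: ge_inf => //; apply: Xact => //.
    exact: (subgroupV sH).
  apply/eqP; rewrite eq_le le //= -(ler_act g^-1%g) actVK.
  by apply: le; exact: (subgroupV sH).
have gb : act g (sup X) = sup X.
  have ge h : H h -> sup X <= act h (sup X).
    move=> Hh; apply: ge_sup => // t Xt.
    rewrite -(actKV h t) ler_act; apply: ub_le_sup => //; apply: Xact => //.
    exact: (subgroupV sH).
  apply/eqP; rewrite eq_le ge // andbT -(ler_act g^-1%g) actVK.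
  by apply: ge; exact: (subgroupV sH).
have iX : ~ X (inf X) by move=> /nofix/eqP.
have sX : ~ X (sup X) by move=> /nofix/eqP.
have iu : inf X < \val u.
  rewrite lt_neqAle ge_inf // andbT; apply/eqP => iE; apply: iX.
  by rewrite iE.
have us : \val u < sup X.
  rewrite lt_neqAle ub_le_sup // andbT; apply/eqP => sE; apply: sX.
  by rewrite -sE.
exists (inf X), (sup X); split.
- by apply: lb_le_inf => // t /X01/andP[].
- exact: lt_trans us.
- by apply: ge_sup => // t /X01/andP[].
- by rewrite AE /Rhull asboolT // asboolF // asboolT // asboolF.
split => // t /andP[it ts]; apply/eqP => gt.
have [ut|tu|utE] := ltgtP (\val u) t.
- suff : sup X <= t by lra.
  apply: ge_sup => // _ [e He <-].
  by rewrite -(cyclic_fix gt He) ler_act ltW.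
- suff : t <= inf X by lra.
  apply: lb_le_inf => // _ [e He <-].
  by rewrite -(cyclic_fix gt He) ler_act ltW.
- by have /eqP := nofix _ Xu; rewrite utE.
Qed.

Lemma elt_orbital_exists g : g <> 1%g -> exists A, elt_orbital g A.
Proof.
move=> g1.
have [t [t01 gt]] : exists t, 0 <= t <= 1 /\ act g t <> t.
  apply: contrapT => no; apply: g1; apply: act_eq1 => t t01.
  by apply: contrapT => gt; apply: no; exists t.
have [u ut] := unitI_surj t01.
exists [set` Rhull [set \val (e u) | e in subgroup_gen [set g]]]; split; last by exists u.
move=> sub1; apply: gt; rewrite -ut act_val; apply: sub1; apply: sub_Rhull.
  by exists g => //; exact: sub_gen_smallest.
by exists 1%g => //; apply: subgroup1; exact: subgroup_gen_subgroup.
Qed.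

End Orbitals.

(** * Free actions of abelian groups on an interval *)

Section FreeAbelian.
Context {R : realType} (N : set (homeoI R)) (p q : R).
Implicit Types (e f g h k l : homeoI R) (d s t x y z : R).

Hypothesis Nsub : subgroup N.
Hypothesis Ncomm : forall k l, N k -> N l -> commute k l.
Hypothesis Nfixp : forall k, N k -> act k p = p.
Hypothesis Nfixq : forall k, N k -> act k q = q.
Hypothesis Nfree : forall k, N k -> k <> 1%g -> forall t, p < t < q -> act k t != t.

Lemma free_act_in k x : N k -> p < x < q -> p < act k x < q.
Proof.
by move=> Nk; rewrite -{2}(Nfixp Nk) -{2}(Nfixq Nk) !ltr_act.
Qed.

Lemma free_moves_right k x y : N k -> p < x < q -> p < y < q ->
  x < act k x -> y < act k y.
Proof.
move=> Nk xJ yJ xk; apply: (@act_sign _ k p q _ x) => //; apply: Nfree => // k1.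
by move: xk; rewrite k1 act1 ltxx.
Qed.

(** Freeness makes the order of the images of a point independent of the
    point, hence an order on [N]. *)
Lemma free_ltr k l x y : N k -> N l -> p < x < q -> p < y < q ->
  act k x < act l x -> act k y < act l y.
Proof.
move=> Nk Nl xJ yJ kl; rewrite -(ltr_act k^-1%g) actVK -actM.
apply: (@free_moves_right _ x) => //.
  by apply: (subgroupM Nsub) => //; exact: (subgroupV Nsub).
by rewrite actM -(ltr_act k) actKV.
Qed.

Lemma free_ler k l x y : N k -> N l -> p < x < q -> p < y < q ->
  act k x <= act l x -> act k y <= act l y.
Proof.
by move=> Nk Nl xJ yJ; rewrite !leNgt; apply: contra; exact: free_ltr.
Qed.

Lemma free_inj k l x : N k -> N l -> p < x < q -> act k x = act l x -> k = l.
Proof.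
move=> Nk Nl xJ kl; apply: contrapT => kl1.
have Nm : N (k^-1 * l)%g by apply: (subgroupM Nsub) => //; exact: (subgroupV Nsub).
have m1 : (k^-1 * l)%g <> 1%g; last first.
  by have /eqP := Nfree Nm m1 xJ; rewrite actM -kl actVK.
by move=> /(congr1 (fun m => k * m)%g); rewrite mulVKg mulg1 => /esym.
Qed.

Lemma free_lerX k l x n : N k -> N l -> p < x < q ->
  act k x <= act l x -> act (k ^+ n)%g x <= act (l ^+ n)%g x.
Proof.
move=> Nk Nl xJ kl; elim: n => [|n IHn]; first by rewrite !expg0.
have lnJ : p < act (l ^+ n)%g x < q.
  by apply: free_act_in => //; exact: (subgroupX Nsub).
rewrite !expgS !actM (@le_trans _ _ (act k (act (l ^+ n)%g x))) ?ler_act //.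
exact: (@free_ler _ _ x).
Qed.

Lemma free_geX k x n : N k -> p < x < q -> x < act k x -> x <= act (k ^+ n)%g x.
Proof.
move=> Nk xJ xk.
rewrite -[X in X <= _](act1 x) -(expg1n _ n); apply: free_lerX => //.
  exact: subgroup1.
by rewrite act1 ltW.
Qed.

Lemma free_escape k x y : N k -> p < x < q -> y < q -> x < act k x ->
  exists n, y < act (k ^+ n)%g x.
Proof.
move=> Nk xJ yq xk; apply: act_escape => // t /andP[xt ty].
apply: Nfree => //; last by lra.
by move=> k1; move: xk; rewrite k1 act1 ltxx.
Qed.

Lemma free_escapeV k x y : N k -> p < x < q -> p < y -> x < act k x ->
  exists n, act (k^-1 ^+ n)%g x < y.
Proof.
move=> Nk xJ py xk; have [xy|yx] := ltP x y.
  by exists 0%N; rewrite expg0 act1.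
have yJ : p < y < q by lra.
have yk : y < act k y by exact: (@free_moves_right _ x).
have [|n xn] := @free_escape k y x Nk yJ _ yk; first by lra.
by exists n; rewrite -(ltr_act (k ^+ n)%g) expVgn actKV.
Qed.

(** * A normalizing map with an interval of support *)

Section Normalized.
Variables (f : homeoI R) (a b : R).
Hypothesis pa : p < a.
Hypothesis ab : a < b.
Hypothesis bq : b < q.
Hypothesis fN : forall k, N k -> N (k ^ f)%g.
Hypothesis fVN : forall k, N k -> N (k ^ f^-1)%g.
Hypothesis fa : act f a = a.
Hypothesis fb : act f b = b.
Hypothesis ffree : forall t, a < t < b -> act f t != t.
Hypothesis fcomm : forall k, N k -> commute f k -> k = 1%g.

Let aJ : p < a < q. Proof. by have := conj pa (conj ab bq); lra. Qed.
Let bJ : p < b < q. Proof. by have := conj pa (conj ab bq); lra. Qed.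

(** The comparison with 1 in the order of [N], tested at the point [a]. *)
Definition positive k := N k /\ a < act k a.

(** The conjugates of [k] by [f] and by its inverse lie on different sides of
    [k], as neither of them is [k]. *)
Lemma no_least_positive k : positive k ->
  exists2 l, positive l & act l a < act k a.
Proof.
move=> [Nk ak].
have k1a : act (k ^ f^-1)%g a = act f (act k a).
  by rewrite conjgE invgK !actM (act_fixV fa).
have k2a : act (k ^ f)%g a = act f^-1%g (act k a).
  by rewrite conjgE !actM fa.
have [lt|gt|e] := ltgtP (act f (act k a)) (act k a).
- exists (k ^ f^-1)%g; rewrite /positive k1a //; split; first exact: fVN.
  by rewrite -[X in X < _]fa ltr_act.
- exists (k ^ f)%g; rewrite /positive k2a.
    by split; [exact: fN|rewrite -(ltr_act f) fa actKV].
  by rewrite -(ltr_act f) actKV.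
- have kE : (k ^ f^-1)%g = k.
    by apply: (@free_inj _ _ a) => //; [exact: fVN|rewrite k1a].
  have k1 : k = 1%g.
    apply: fcomm => //; rewrite /commute -{2}kE conjgE invgK.
    by rewrite -!mulgA mulVg mulg1.
  by move: ak; rewrite k1 act1 ltxx.
Qed.

(** If [1 < l < k] then the smaller of [l] and [k / l] has its square at most
    [k]. *)
Lemma halve_positive k : positive k ->
  exists2 l, positive l & act (l ^+ 2)%g a <= act k a.
Proof.
move=> pk; have [l [Nl al] lk] := no_least_positive pk; case: pk => Nk ak.
have [le|gt] := leP (act (l ^+ 2)%g a) (act k a); first by exists l.
have NlV := subgroupV Nsub Nl.
have Nm : N (k / l)%g by exact: (subgroupM Nsub).
have Nl2 := subgroupX Nsub 2 Nl.
have ckl : commute k l^-1%g by exact: Ncomm.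
exists (k / l)%g.
  by split=> //; rewrite ckl actM -(ltr_act l) actKV.
rewrite expgnFl; last exact: Ncomm.
have -> : (k ^+ 2 / l ^+ 2)%g = (k * l ^- 2 * k)%g.
  rewrite expg2 -mulgA -mulgA; congr (k * _)%g; apply: Ncomm => //.
  exact: (subgroupV Nsub).
have NV2 := subgroupV Nsub Nl2.
have kaJ : p < act k a < q by exact: free_act_in.
rewrite !actM ltW // -[X in _ < X](actKV (l ^+ 2)%g).
by apply: (@free_ltr _ _ a) => //; exact: free_act_in.
Qed.

Lemma positive_root M k : positive k ->
  exists2 l, positive l & act (l ^+ M.+1)%g a <= act k a.
Proof.
move=> pk; elim: M => [|M [l pl IHl]]; first by exists k; rewrite ?expg1.
have [m pm ml] := halve_positive pl; exists m => //.
case: pm => Nm am; case: pl => Nl al.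
apply: le_trans IHl; apply: (@le_trans _ _ (act (m ^+ (2 * M.+1))%g a)).
  have -> : (2 * M.+1 = M.+2 + M)%N by rewrite mul2n -addnn [RHS]addSnnS.
  by rewrite (expgnDr m M.+2 M) (actM (m ^+ M.+2)%g) ler_act; exact: free_geX.
by rewrite expgnA; apply: free_lerX => //; exact: (subgroupX Nsub).
Qed.

(** Suppose [a < k a < b] and let [m] be such that [k^m a > b].  Conjugating
    [k] by a suitable power of [f] keeps the latter property, since [f] fixes
    [a] and [b], but brings [k a] as close to [a] as desired, in particular
    below [l a] for a positive [l] with [l^(m+1) <= k].  But [l^m a <= k a < b].
*)
Lemma positive_jumps k : positive k -> b <= act k a.
Proof.
move=> pk; have [Nk ak] := pk; rewrite leNgt; apply/negP => kab.
have [m mb] := free_escape Nk aJ bq ak.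
have [l [Nl al] lm] := positive_root m pk.
have lk : act l a <= act k a.
  apply: le_trans lm; rewrite expgSr actM -[X in X <= _]act1 -(expg1n _ m).
  apply: free_lerX => //; [exact: subgroup1|exact: free_act_in|].
  rewrite act1 ltW //; apply: (@free_moves_right _ a) => //; exact: free_act_in.
(* A conjugator [e] bringing [k a] below [l a] suffices. *)
suff [e [eN ea eb ek]] : exists e, [/\ forall m, N m -> N (m ^ e^-1)%g,
    act e a = a, act e b = b & act e (act k a) <= act l a].
  have Nke := eN _ Nk.
  have kea : act (k ^ e^-1)%g a <= act l a.
    by rewrite conjgE invgK !actM (act_fixV ea).
  have kmea : b < act ((k ^ e^-1) ^+ m)%g a.
    by rewrite -conjXg conjgE invgK !actM (act_fixV ea) -[X in X < _]eb ltr_act.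
  have := free_lerX m Nke Nl aJ kea.
  have lmm : act (l ^+ m)%g a <= act (l ^+ m.+1)%g a.
    by rewrite expgSr actM ler_act ltW.
  lra.
(* Either [f] or its inverse moves [l a] to the left; the iterates of that map
   then bring [k a] below [l a]. *)
have shrink e : (forall m, N m -> N (m ^ e^-1)%g) -> act e a = a -> act e b = b ->
    (forall t, a < t < b -> act e t != t) -> act l a < act e^-1%g (act l a) ->
    exists e, [/\ forall m, N m -> N (m ^ e^-1)%g,
      act e a = a, act e b = b & act e (act k a) <= act l a].
  move=> eN ea eb efree le.
  have [t /andP[lt tk]|n ekl] := @act_escape _ e^-1%g (act l a) (act k a) _ le.
    have := efree t ltac:(lra); apply: contra => /eqP/act_fixV.
    by rewrite invgK => /eqP.
  exists (e ^+ n)%g; split; last 1 first.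
  - by rewrite ltW // -(ltr_act (e ^+ n)^-1%g) actVK -expVgn.
  - elim: n {ekl} => [|n IHn] j Nj; first by rewrite expg0 invg1 conjg1.
    by rewrite expgSr invgM conjgM; apply: IHn; exact: eN.
  - exact: actX_fix.
  - exact: actX_fix.
have lab : a < act l a < b by rewrite al (le_lt_trans lk).
have := ffree lab; rewrite neq_lt => /orP[fl|fl].
- apply: (shrink f) => //.
  by rewrite -(ltr_act f) actKV.
- apply: (shrink f^-1%g); rewrite ?(act_fixV fa) ?(act_fixV fb) ?invgK //.
  by move=> t /ffree; apply: contra => /eqP/act_fixV; rewrite invgK => /eqP.
Qed.


Hypothesis Nan : forall k, N k -> analyticI k.
Hypothesis p0 : 0 <= p.
Hypothesis q1 : q <= 1.

Let bounds : [/\ p < a, a < b, b < q, 0 <= p & q <= 1].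
Proof. by []. Qed.

(** Since [k] fixes [p] and moves points to the right, its difference
    quotients between [p] and another point are at least 1; those between two
    points near [p] are close to them. *)
Lemma slope_ge_half k : N k -> (forall x, p < x < q -> x <= act k x) ->
  exists2 d, 0 < d & forall x z, p < x -> x <= z -> z < q -> z <= p + d ->
    (z - x) / 2 <= act k z - act k x.
Proof.
move=> Nk kge; have [pa' ab' bq' p0' q1'] := bounds.
have p01 : 0 <= p <= 1 by lra.
have [K [d [K0 d0 diff2]]] := analytic_diff2_bounded (Nan Nk) p01.
have K1 : 0 < 2 * (K + 1) by lra.
exists (Num.min d (1 / (2 * (K + 1)))); first by rewrite lt_min d0 divr_gt0.
move=> x z px xz zq zd.
have [zd1 zd2] : z <= p + d /\ z - p <= 1 / (2 * (K + 1)).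
  by split; [|rewrite lerBlDl]; apply: le_trans zd _; rewrite lerD2l ge_min lexx ?orbT.
have Kz : K * (z - p) <= 1 / 2.
  by move: zd2; rewrite ler_pdivlMr // => h; nra.
have := diff2 x p z; rewrite (Nfixp Nk) => /(_ ltac:(lra) ltac:(lra) ltac:(lra)).
move=> /(_ ltac:(lra) ltac:(lra) ltac:(lra)).
rewrite [`|z - x|]ger0_norm ?subr_ge0 //.
rewrite [`|p - x|]distrC [`|x - p|]gtr0_norm ?subr_gt0 //.
rewrite [`|z - p|]gtr0_norm; last by lra.
rewrite ler_norml => /andP[_ h].
have xk : x - p <= act k x - p by rewrite lerD2r kge //; lra.
have xp : 0 < x - p by lra.
rewrite -(ler_pM2r xp).
have h1 : (x - p) * (z - x) <= (act k x - p) * (z - x) by rewrite ler_wpM2r // subr_ge0.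
have h2 : K * (z - p) * ((z - x) * (x - p)) <= 1 / 2 * ((z - x) * (x - p)).
  by rewrite ler_wpM2r // mulr_ge0 ?subr_ge0 // ltW.
lra.
Qed.

Lemma slope_powers_ge_half l M : positive l ->
  exists2 d, 0 < d & forall i, (i <= M)%N ->
    forall x z, p < x -> x <= z -> z < q -> z <= p + d ->
    (z - x) / 2 <= act (l ^+ i)%g z - act (l ^+ i)%g x.
Proof.
move=> [Nl al].
have lge i x : p < x < q -> x <= act (l ^+ i)%g x.
  by move=> xJ; apply: free_geX => //; exact: (@free_moves_right _ a).
elim: M => [|M [d d0 dM]].
  have [d d0 dM] := slope_ge_half (subgroupX Nsub 0 Nl) (lge 0%N).
  by exists d => // i; rewrite leqn0 => /eqP ->.
have [d' d'0 dM'] := slope_ge_half (subgroupX Nsub M.+1 Nl) (lge M.+1).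
exists (Num.min d d'); first by rewrite lt_min d0.
move=> i iM x z px xz zq zd.
have [zd1 zd2] : z <= p + d /\ z <= p + d'.
  by split; apply: le_trans zd _; rewrite lerD2l ge_min lexx ?orbT.
by move: iM; rewrite leq_eqVlt => /orP[/eqP ->|iM]; [exact: dM'|exact: dM].
Qed.

(** * Bounded distortion *)

Section Distortion.
Variable h : homeoI R.
Hypothesis ph : positive h.

Let X n := act (h^-1 ^+ n)%g a.
Let Y n := act (h^-1 ^+ n)%g b.

Let Nh : N h. Proof. by case: ph. Qed.
Let ah : a < act h a. Proof. by case: ph. Qed.
Let NhV n : N (h^-1 ^+ n)%g.
Proof. by apply: (subgroupX Nsub); exact: (subgroupV Nsub). Qed.
Let XJ n : p < X n < q. Proof. exact: free_act_in. Qed.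
Let YJ n : p < Y n < q. Proof. exact: free_act_in. Qed.
Let XY n : X n < Y n. Proof. by rewrite ltr_act. Qed.
Let hX n : act h (X n.+1) = X n. Proof. by rewrite /X expgS actM actKV. Qed.
Let hY n : act h (Y n.+1) = Y n. Proof. by rewrite /Y expgS actM actKV. Qed.

Let Xlow l n : positive l -> Y n <= act l (X n).
Proof.
move=> pl; have [Nl _] := pl.
have -> : act l (X n) = act (h^-1 ^+ n)%g (act l a).
  by rewrite -!actM; congr act; exact: Ncomm.
by rewrite ler_act; exact: positive_jumps.
Qed.

Let YX n : Y n.+1 <= X n. Proof. by rewrite -[X n]hX; exact: Xlow. Qed.

Let Ydecr n m : Y (n + m)%N <= Y n.
Proof.
elim: m => [|m IHm]; first by rewrite addn0.
by rewrite addnS (le_trans _ IHm) // (le_trans (YX _)) // ltW.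
Qed.

Let Yto y : p < y -> exists n0, forall n, (n0 <= n)%N -> Y n <= y.
Proof.
move=> py; have [n0 n0y] := free_escapeV Nh bJ py (free_moves_right Nh aJ bJ ah).
by exists n0 => n /subnKC <-; rewrite (le_trans (Ydecr _ _)) // ltW.
Qed.

(** Write [x], [y], [z] for the points [X n.+1], [Y n.+1] and [X n]; [h] sends
    them to [X n], [Y n] and [h (X n)].  By the bound on second differences, the
    ratio [(z - x) / (y - x)] exceeds its predecessor at most by the factor
    [1 + 2 K (z - y)], where 2 comes from the slopes of [h] being at least 1/2.
    As [z - y <= X n - X n.+1], the product of these factors is at most the
    exponential of a telescoping sum. *)
Lemma bounded_distortion : exists C n0, forall n, (n0 <= n)%N ->
  act h (X n) - X n <= C * (Y n - X n).
Proof.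
have [pa' ab' bq' p0' q1'] := bounds.
have p01 : 0 <= p <= 1 by lra.
have [K [d1 [K0 d10 diff2]]] := analytic_diff2_bounded (Nan Nh) p01.
have hge x : p < x < q -> x <= act h x.
  by move=> xJ; apply/ltW/(@free_moves_right _ a).
have [d2 d20 slope] := slope_ge_half Nh hge.
pose d := Num.min d1 d2.
have d0 : 0 < d by rewrite lt_min d10.
have [dd1 dd2] : d <= d1 /\ d <= d2 by rewrite !ge_min !lexx orbT.
have [n0 Yn0] : exists n0, forall n, (n0 <= n)%N -> Y n <= p + d by apply: Yto; lra.
pose C0 := (act h (X n0) - X n0) / (Y n0 - X n0).
have hXX n : X n < act h (X n) by exact: (@free_moves_right _ a).
have C00 : 0 <= C0.
  by rewrite divr_ge0 // subr_ge0 ltW.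
exists (C0 * expR (2 * K)), n0 => n /subnKC <-; move: (n - n0)%N => {}n.
suff claim : act h (X (n0 + n)%N) - X (n0 + n)%N <=
    C0 * expR (2 * K * (X n0 - X (n0 + n)%N)) * (Y (n0 + n)%N - X (n0 + n)%N).
  apply: le_trans claim _; rewrite ler_wpM2r ?subr_ge0 ?(ltW (XY _)) //.
  rewrite ler_wpM2l // ler_expR.
  have := XJ n0; have := XJ (n0 + n)%N; nra.
elim: n => [|n IHn].
  by rewrite addn0 subrr mulr0 expR0 mulr1 /C0 divfK // subr_eq0 gt_eqF.
rewrite addnS; set m := (n0 + n)%N in IHn *.
have mn0 : (n0 <= m)%N by rewrite leq_addr.
have Xm := Yn0 _ mn0.
have := (XJ m, XJ m.+1, (YJ m.+1, XY m, XY m.+1), (YX m, hXX m)).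
move=> [[[XJm XJm1] [[YJm1 XYm] XYm1]] [YXm hXXm]].
have := diff2 (X m.+1) (Y m.+1) (X m) ltac:(lra) ltac:(lra) ltac:(lra)
  ltac:(lra) ltac:(lra) ltac:(lra).
have := slope (X m.+1) (X m) ltac:(lra) ltac:(lra) ltac:(lra) ltac:(lra).
rewrite !hX hY => sl.
rewrite [`|X m - X m.+1|]gtr0_norm; last lra.
rewrite [`|Y m.+1 - X m.+1|]gtr0_norm; last lra.
rewrite [`|X m - Y m.+1|]ger0_norm; last lra.
rewrite ler_norml => /andP[tm _].
pose E := C0 * expR (2 * K * (X n0 - X m)).
pose D := X m - X m.+1.
have E0 : 0 <= E by rewrite mulr_ge0 // expR_ge0.
have D0 : 0 < D by rewrite /D; lra.
have step : (Y m - X m) * D <=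
    E * (Y m - X m) * (Y m.+1 - X m.+1) * (1 + 2 * K * D).
  have h1 : (X m - X m.+1) * (Y m.+1 - X m.+1) * (X m - Y m.+1) <=
      2 * (act h (X m) - X m) * (Y m.+1 - X m.+1) * D.
    apply: ler_pM => //; rewrite ?mulr_ge0 //; rewrite /D; try lra.
    rewrite ler_wpM2r //; lra.
  have h2 : (Y m - X m) * D <=
      (act h (X m) - X m) * (Y m.+1 - X m.+1) * (1 + 2 * K * D).
    have := ler_wpM2l K0 h1; rewrite /D in tm *; lra.
  apply: le_trans h2 _; rewrite ler_wpM2r //.
    by rewrite addr_ge0 // !mulr_ge0 // ltW.
  by rewrite ler_wpM2r //; lra.
have XYm0 : 0 < Y m - X m by lra.
have -> : C0 * expR (2 * K * (X n0 - X m.+1)) = E * expR (2 * K * D).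
  by rewrite /E -[RHS]mulrA -expRD; congr (_ * expR _); rewrite /D; ring.
rewrite -(ler_pM2l XYm0); apply: le_trans step _.
have -> : (Y m - X m) * (E * expR (2 * K * D) * (Y m.+1 - X m.+1)) =
  E * (Y m - X m) * (Y m.+1 - X m.+1) * expR (2 * K * D) by ring.
apply: ler_wpM2l; last exact: expR_ge1Dx.
by rewrite mulr_ge0 ?subr_ge0 ?(ltW XYm1) // mulr_ge0 // ltW.
Qed.

(** [M] disjoint images of [[X n, Y n]], each at least half as long, fit into
    [[X n, h (X n)]], for arbitrary [M]. *)
Lemma no_positive_element : False.
Proof.
have [C [n0 Cn]] := bounded_distortion.
have [M MC] : exists M : nat, 2 * C < M%:R.
  exists (Num.bound (2 * `|C|)); apply: le_lt_trans (archi_boundP _).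
    by rewrite ler_wpM2l // ler_norm.
  by rewrite mulr_ge0.
have [l pl lM] := positive_root M ph.
have [Nl al] := pl.
have [d d0 slope] := slope_powers_ge_half M pl.
have [n1 Yn1] : exists n1, forall n, (n1 <= n)%N -> Y n <= p + d by apply: Yto; lra.
pose n := maxn n0 n1.
have {}Cn := Cn n (leq_maxl _ _).
have {}Yn1 := Yn1 n (leq_maxr _ _).
have := (XJ n, YJ n, XY n) => -[[XJn YJn] XYn].
have sum j : (j <= M)%N -> j%:R / 2 * (Y n - X n) <= act (l ^+ j)%g (X n) - X n.
  elim: j => [|j IHj] jM; first by rewrite expg0 act1 subrr !mul0r.
  have {}IHj := IHj (ltnW jM).
  have sl := slope j (ltnW jM) (X n) (Y n) ltac:(lra) ltac:(lra) ltac:(lra) Yn1.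
  have : act (l ^+ j)%g (Y n) <= act (l ^+ j.+1)%g (X n).
    by rewrite expgSr actM ler_act; exact: Xlow.
  by rewrite -[j.+1]addn1 natrD; lra.
have {}sum := sum M (leqnn M).
have lMh : act (l ^+ M)%g (X n) <= act h (X n).
  apply: (@free_ler _ _ a) => //; first exact: (subgroupX Nsub).
  by apply: le_trans lM; rewrite expgSr actM ler_act ltW.
nra.
Qed.

End Distortion.
End Normalized.
End FreeAbelian.

(** * Strict towers *)

Section Heights.
Variable R : realType.
Implicit Types (G : set (homeoI R)) (e f g h k : homeoI R) (a b c d s t x y z : R).

Lemma no_nested_orbitals G f g a b c d :
  subgroup G -> G `<=` @diff_omega R -> solvable_subgroup G -> G f -> G g ->
  0 <= c -> c < a -> a < b -> b < d -> d <= 1 ->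
  act f a = a -> act f b = b -> (forall t, a < t < b -> act f t != t) ->
  (forall t, c < t < d -> act g t != t) -> False.
Proof.
move=> sG Gan Gsol Gf Gg c0 ca ab bd d1 fa fb ffree gfree.
have an e : G e -> analyticI e by move=> /Gan[].
have f1 : f <> 1%g.
  move=> f1; have /eqP := ffree ((a + b) / 2) ltac:(lra).
  by rewrite f1 act1.
have G1 : G <> [set 1%g] by move=> G1; apply: f1; move: Gf; rewrite G1.
have [N [sN NG Nnorm Ncomm [h Nh h1]]] := solvable_abelian_normal sG Gsol G1.
(* All nontrivial elements of [N] have the same fixed points. *)
have fix_transfer k l : N k -> k <> 1%g -> N l ->
    forall t, act k t = t -> act l t = t.
  move=> Nk k1 Nl t kt.
  have [t01|/act_out ->//] := boolP (0 <= t <= 1).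
  apply: (@fix_of_permutes_fix _ k) => // [|y]; first exact/an/NG.
  rewrite -actM (Ncomm _ _ Nk Nl) actM; split => [-> //|]; exact: act_inj.
(* For [e] in [G], the conjugate [h ^ e] has the fixed points of [h], so [e]
   permutes them. *)
have Gfix e : G e -> forall t, act h t = t -> act e t = t.
  move=> Ge t ht.
  have [t01|/act_out ->//] := boolP (0 <= t <= 1).
  have he1 : (h ^ e)%g <> 1%g by move=> /eqP; rewrite conjg_eq1 => /eqP.
  have Nhe : N (h ^ e)%g by exact: Nnorm.
  apply: (@fix_of_permutes_fix _ h) => // [|y]; first exact/an/NG.
  have heE : act (h ^ e)%g y = act e^-1%g (act h (act e y)) by rewrite conjgE !actM.
  split => [hy|hey].
    have := fix_transfer h (h ^ e)%g Nh h1 Nhe y hy.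
    by rewrite heE => /(congr1 (act e)); rewrite actKV.
  by apply: (fix_transfer (h ^ e)%g) => //; rewrite heE hey actVK.
have hfree t : c < t < d -> act h t != t.
  by move=> /gfree; apply: contra => /eqP/(Gfix _ Gg) ->.
(* The component of the complement of the fixed set containing [a] and [b]. *)
pose P := [set t | act h t = t /\ t <= a].
pose Q := [set t | act h t = t /\ b <= t].
have P0 : P 0 by split; [exact: act0|lra].
have Q1 : Q 1 by split; [exact: act_1|lra].
have neP : P !=set0 by exists 0.
have neQ : Q !=set0 by exists 1.
have ubP : has_ubound P by exists a => t [].
have lbQ : has_lbound Q by exists b => t [].
have hp : act h (sup P) = sup P by apply: act_sup => // t [].
have hq : act h (inf Q) = inf Q by apply: act_inf => // t [].
have p0 : 0 <= sup P by exact: ub_le_sup.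
have q1 : inf Q <= 1 by exact: ge_inf.
have pa : sup P < a.
  rewrite lt_neqAle ge_sup ?andbT //; last by move=> t [].
  by apply/eqP => pE; have /eqP := hfree a ltac:(lra); rewrite -pE.
have bq : b < inf Q.
  rewrite lt_neqAle lb_le_inf ?andbT //; last by move=> t [].
  by apply/eqP => qE; have /eqP := hfree b ltac:(lra); rewrite qE.
have hfreeJ t : sup P < t < inf Q -> act h t != t.
  move=> tJ; apply/negP => /eqP ht.
  have [ta|at_] := leP t a.
    have : t <= sup P by apply: ub_le_sup.
    lra.
  have [bt|tb] := leP b t.
    have : inf Q <= t by apply: ge_inf.
    lra.
  by have /eqP := hfree t ltac:(lra).
have Nfree k : N k -> k <> 1%g ->
    forall t, sup P < t < inf Q -> act k t != t.
  by move=> Nk k1 t /hfreeJ; apply: contra => /eqP/(fix_transfer k h) ->.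
have fcomm k : N k -> commute f k -> k = 1%g.
  move=> Nk fk; apply: contrapT => k1.
  have /eqP := Nfree k Nk k1 a ltac:(lra); apply.
  apply: (@fix_of_permutes_fix _ f) => // [||y]; [exact: an|lra|].
  rewrite -actM fk actM; split => [-> //|]; exact: act_inj.
have pos k : N k -> a < act k a -> False.
  move=> Nk ak.
  apply: (@no_positive_element R N (sup P) (inf Q) sN _ _ _ _ f a b
    _ _ _ _ _ _ _ _ _ _ _ _ k) => //.
  - by move=> l Nl; exact: Gfix (NG _ Nl) _ hp.
  - by move=> l Nl; exact: Gfix (NG _ Nl) _ hq.
  - by move=> l; exact: Nnorm.
  - by move=> l; apply: Nnorm; exact: (subgroupV sG).
  - by move=> l /NG/an.
have := hfreeJ a ltac:(lra); rewrite neq_lt => /orP[ha|]; last exact: pos.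
apply: (pos h^-1%g); first exact: (subgroupV sN).
by rewrite -(ltr_act h) actKV.
Qed.

Lemma counting_set1 (T : choiceType) (x : T) : counting [set x] = 1%E :> \bar R.
Proof.
rewrite /counting asboolT; last exact: finite_set1.
by rewrite fset_set1 (finmap.cardfs1 x).
Qed.

Lemma counting_subset1_le (T : choiceType) (X : set T) :
  is_subset1 X -> (counting X <= 1 :> \bar R)%E.
Proof.
move=> X1; have [->|/set0P[x Xx]] := eqVneq X set0.
  by rewrite /counting asboolT ?fset_set0 // finmap.cardfs0.
suff -> : X = [set x] by rewrite counting_set1.
by apply/seteqP; split => [y Xy|_ -> //]; exact: X1.
Qed.

Lemma subset_itvoo_bounds a b c d :
  a < b -> `]a, b[ `<=` `]c, d[ -> c <= a /\ b <= d.
Proof.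
move=> ab sub; have sub' t : a < t < b -> c < t < d.
  by have := sub t; rewrite /= !in_itv.
split; rewrite leNgt; apply/negP => lt.
- have [bc|cb] := leP b c; [have := sub' ((a + b) / 2)|have := sub' ((a + c) / 2)]; lra.
- have [da|ad] := leP d a; [have := sub' ((a + b) / 2)|have := sub' ((d + b) / 2)]; lra.
Qed.

Lemma strict_tower_subset1 G T : subgroup G -> G `<=` @diff_omega R ->
  solvable_subgroup G -> strict_tower G T -> is_subset1 (tower_intervals T).
Proof.
move=> sG Gan Gsol [[Torb Tchain _] Tstrict].
have nested A B : tower_intervals T A -> tower_intervals T B -> A `<=` B -> A = B.
  move=> TA TB AB; apply: contrapT => neAB.
  have noshare := Tstrict _ _ TA TB neAB.
  case: TA TB => [[A' f] /Torb[/= Gf fA] AE] [[B' g] /Torb[/= Gg gB] BE].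
  have [a [b [_ ab _ A'E [fa fb ffree]]]] := elt_orbitalP fA.
  have [c [d [c0 cd d1 B'E [_ _ gfree]]]] := elt_orbitalP gB.
  have [ca bd] : c <= a /\ b <= d.
    by apply: subset_itvoo_bounds => //; rewrite -A'E -B'E AE BE.
  have [ca' bd'] : c != a /\ b != d.
    by split; apply/eqP => e; apply: noshare; exists a, b, c, d; split;
      rewrite -?AE -?BE //; [left|right].
  apply: (@no_nested_orbitals G f g a b c d) => //.
    by rewrite lt_neqAle ca'.
  by rewrite lt_neqAle bd'.
move=> A B TA TB; have [AB|BA] := Tchain _ _ TA TB; first exact: nested.
by apply/esym; exact: nested.
Qed.

Lemma singleton_strict_tower G g A : G g -> elt_orbital g A ->
  strict_tower G [set (A, g)].
Proof.
move=> Gg gA; have TE B : tower_intervals [set (A, g)] B -> B = A by move=> [_ -> <-].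
split; first split.
- by move=> _ ->; split.
- by move=> B C /TE -> /TE ->; left.
- by move=> B /TE ->; exists g; split => // h [].
- by move=> B C /TE -> /TE ->.
Qed.

End Heights.

Theorem theorem1p7 (R : realType) (Gamma : set (homeoI R))
  (Gamma_subgroup : subgroup Gamma)
  (Gamma_analytic : Gamma `<=` @diff_omega R)
  (Gamma_solvable : solvable_subgroup Gamma)
  (Gamma_nontrivial : Gamma <> [set 1%g]) :
  strict_height Gamma = 1%E.
Proof.
apply/eqP; rewrite eq_le; apply/andP; split.
  apply: ge_ereal_sup => _ [T strictT <-]; apply: counting_subset1_le.
  exact: (strict_tower_subset1 Gamma_subgroup).
have [g Gg g1] : exists2 g, Gamma g & g <> 1%g.
  apply: contrapT => triv; apply: Gamma_nontrivial; apply/seteqP.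
  split=> [g Gg|_ ->]; last exact: subgroup1.
  by apply: contrapT => g1; apply: triv; exists g.
have [A gA] := elt_orbital_exists g1.
apply: ereal_sup_ubound; exists [set (A, g)]; first exact: singleton_strict_tower.
by rewrite /tower_height /tower_intervals image_set1 counting_set1.
Qed.
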